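(* Let $G$ be a profinite group having only countably many values of the word $w=[x^2,y]$, i.e. such that the set $\{[g^2,h] \mid g,h\in G\}$ is countable. Then the verbal subgroup $w(G)$ is finite.
   Context: Commutators are $[x,y]=x^{-1}y^{-1}xy$. For a profinite group $G$ and a group word $w$, the verbal subgroup $w(G)$ is the closed subgroup of $G$ (topologically) generated by all values of $w$ in $G$. ''Countable'' means finite or countably infinite. *)

(* Defs.v *)
From HB Require Import structures.
From mathcomp Require Import all_boot.
From mathcomp Require Import mathcomp_extra boolp classical_sets functions.
From mathcomp Require Import cardinality filter topology.

Set Implicit Arguments.
Unset Strict Implicit.
Unset Printing Implicit Defensive.

Local Open Scope classical_set_scope.
Local Open Scope group_scope.

HB.mixin Record isTopologicalGroup G of Topological G & Group G := {
  mulg_continuous : continuous (fun p : G * G => p.1 * p.2);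
  invg_continuous : continuous (fun x : G => x^-1)
}.

#[short(type="topologicalGroupType")]
HB.structure Definition TopologicalGroup :=
  {G of Topological G & Group G & isTopologicalGroup G}.

Definition profinite (G : topologicalGroupType) :=
  [/\ compact [set: G], hausdorff_space G & totally_disconnected [set: G]].

(* The smallest closed subgroup containing A; group_closed also requires
   that 1 belong to H. *)
Definition closed_subgroup_gen (G : topologicalGroupType) (A : set G) : set G :=
  smallest [set H : set G | group_closed (mem H) /\ closed H] A.

(* Formal expressions in countably many variables, representing the elements of
   the free group on these variables. *)
Inductive group_word : Type :=
| WVar of nat
| WOne
| WMul of group_word & group_word
| WInv of group_word.

Definition wcommg (u v : group_word) : group_word :=
  WMul (WMul (WMul (WInv u) (WInv v)) u) v.

Fixpoint weval (G : groupType) (e : nat -> G) (w : group_word) : G :=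
  match w with
  | WVar i => e i
  | WOne => 1
  | WMul u v => weval e u * weval e v
  | WInv u => (weval e u)^-1
  end.

Definition word_values (w : group_word) (G : groupType) : set G :=
  [set weval e w | e in [set: nat -> G]].
Arguments word_values w G : clear implicits.

Definition verbal_subgroup (w : group_word) (G : topologicalGroupType) : set G :=
  closed_subgroup_gen (word_values w G).
Arguments verbal_subgroup w G : clear implicits.

Definition comm_sq_word : group_word :=
  wcommg (WMul (WVar 0%N) (WVar 0%N)) (WVar 1%N).

Lemma word_values_comm_sq (G : groupType) :
  word_values comm_sq_word G =
  [set [~ g ^+ 2, h] | g in [set: G] & h in [set: G]].
Proof.
apply/seteqP; split=> [_ [e _ <-]|_ [g _ [h _ <-]]] /=.
  by exists (e 0%N) => //; exists (e 1%N) => //; rewrite /commg /conjg !mulgA.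
exists (fun i => if i is 0%N then g else h) => //.
by rewrite /= /commg /conjg !mulgA.
Qed.

(* Main.v *)
(* Write X for the set of values and c_g(x) = x (g x g^-1), so that
   (x g)^2 = c_g(x) g^2. By Baire category, a continuous map with countably many
   values is constant near some point. For h |-> [s, h] with s a square, this
   gives an open subgroup centralizing s. For (g, h) |-> [g^2, h] it gives a
   point (g, h) and an open normal subgroup M such that c_g(M) centralizes M.
   Hence g inverts M modulo its centre, so G has an open normal subgroup N of
   class at most 2; since one may take g in any coset of N and M inside N, and
   c_g on M depends on g in its coset only up to the centre of N, every g then
   has such an M. On M the map c_g is a morphism up to factors [m, g u g^-1].
   As [x, y] is a product of three squares, the elements [[x, y], h] form a
   countable set too, so these factors commute with h for u near 1, and hence
   so does c_g(u). Therefore [g^2, h] is locally constant in (g, h), and X is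
   finite.
   If X is finite, each v = [s, h] in X has a power v^n, n > 0, commuting with
   h, and then v^(n+1) = [s, h^2] (v^h)^(n-1) is a product of n elements of X.
   As X is closed under conjugation, repeated factors of a long product of
   elements of X can be gathered and shortened, so the subgroup generated by X
   is finite, hence closed. *)
Require Import Defs.
From HB Require Import structures.
From mathcomp Require Import all_boot.
From mathcomp Require Import mathcomp_extra boolp classical_sets functions.
From mathcomp Require Import cardinality filter topology.

Set Implicit Arguments.
Unset Strict Implicit.
Unset Printing Implicit Defensive.

Local Open Scope classical_set_scope.
Local Open Scope group_scope.

(** * Compact totally disconnected spaces *)

(** Otherwise the parts of the clopen sets [K] outside [O] generate a proper filter; a cluster point
    lies in every such [K], hence in the open set [O], which these parts avoid. *)
Lemma quasicomponent_sub_open (T : topologicalType) (x : T) (O : set T) :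
  compact [set: T] -> open O ->
  (forall y, (forall K, clopen K -> K x -> K y) -> O y) ->
  exists2 K, clopen K /\ K x & K `<=` O.
Proof.
move=> cT oO QO; apply: contrapT => noK.
pose D := [set K : set T | clopen K /\ K x].
have FF : Filter (filter_from D (fun K => K `\` O)).
  apply: filter_from_filter; first by exists setT; split => //; exact: clopenT.
  move=> A B [cA Ax] [cB Bx]; exists (A `&` B).
    by split => //; exact: clopenI.
  by move=> y [[Ay By] nOy].
have PF : ProperFilter (filter_from D (fun K => K `\` O)).
  apply: filter_from_proper => K DK; apply: contrapT => KO; apply: noK.
  by exists K => // y Ky; apply: contrapT => nOy; apply: KO; exists y.
have [|y [_ cly]] := cT _ PF; first exact: filterT.
have FD K : D K -> filter_from D (fun K => K `\` O) (K `\` O) by exists K.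
have Oy : O y.
  apply: QO => K clK Kx; apply: clK.2 => B By.
  have [|z [[Kz _] Bz]] := cly _ B (FD K _) By; first by split.
  by exists z.
have [|z [[_ +] Oz]] := cly _ O (FD setT _) (open_nbhs_nbhs (conj oO Oy)).
  by split => //; exact: clopenT.
by [].
Qed.

(** In a compact Hausdorff space the quasicomponent [Q] of [x] is connected, so total
    disconnectedness reduces it to [x]. *)
Lemma totally_disconnected_zero_dimensional (T : topologicalType) :
  compact [set: T] -> hausdorff_space T -> totally_disconnected [set: T] ->
  zero_dimensional T.
Proof.
move=> cT hT tdT x y xny; apply: contrapT => noU.
pose Q := [set z : T | forall K, clopen K -> K x -> K z].
have Qy : Q y.
  by move=> K cK Kx; apply: contrapT => nKy; apply: noU; exists K.
suff cQ : connected Q.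
  have : connected_component setT x y by exists Q => //; split => // K _ Kx.
  by rewrite tdT // => yx; move: xny; rewrite yx eqxx.
have clQ : closed Q.
  move=> z clz K clK Kx; apply: clK.2 => B /clz [w [Qw Bw]].
  by exists w; split => //; apply: Qw.
move=> B [b Bb] [C oC BC] [D cD BD].
have clB : closed B by rewrite BD; exact: closedI.
have clB' : closed (Q `\` C) by apply: closedI => //; exact: open_closedC.
have nC : set_nbhs B (~` (Q `\` C)).
  apply/set_nbhsP; exists (~` (Q `\` C)); split => //.
    exact: closed_openC.
  by move=> z; rewrite BC => -[_ Cz] -[_]; exact.
have [W /set_nbhsP[U [oU BU UW]] WC] := compact_normal hT cT clB nC.
have clW : closed (closure W) by exact: closed_closure.
have [| |K [[oK cK] Kx] KUV] :=
    @quasicomponent_sub_open _ x (U `|` ~` closure W) cT.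
- by apply: openU => //; exact: closed_openC.
- move=> z Qz; have [Cz|nCz] := pselect (C z).
    by left; apply: BU; rewrite BC.
  by right => /WC; apply.
have KU : K `&` U = K `&` closure W.
  apply/seteqP; split => z [Kz].
    by move=> /UW /subset_closure.
  by move=> Wz; split => //; case: (KUV z Kz).
have cKU : clopen (K `&` U).
  by split; [exact: openI|rewrite KU; exact: closedI].
apply/seteqP; split; first by rewrite BC => z [].
(* Whichever of the trace of [U] on [K] and its complement in [K] contains [x] must contain all of
   [Q]; the point [b] rules out the complement. *)
have [Ux|nUx] := pselect (U x).
  move=> z Qz; rewrite BC; split => //; apply: contrapT => nCz.
  have [_ Uz] := Qz _ cKU (conj Kx Ux).
  by apply: (WC z); [apply/subset_closure/UW|].
have /(_ (K `&` ~` (K `&` U))) Qb : Q b by move: Bb; rewrite BC => -[].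
case: Qb; first by apply: clopenI => //; exact: clopenC.
  by split => // -[].
by move=> Kb []; split => //; exact: BU.
Qed.

(** * Clopen bases and locally constant maps *)

Definition clopen_base (T : topologicalType) := forall (x : T) (W : set T),
  nbhs x W -> exists2 K : set T, clopen K /\ K x & K `<=` W.

Lemma zero_dimensional_clopen_base (T : topologicalType) :
  compact [set: T] -> hausdorff_space T -> zero_dimensional T -> clopen_base T.
Proof.
move=> cT hT zT x W /(zero_dimensional_cvg hT zT cT)[K [Kx clK] KW].
by exists K.
Qed.

Lemma clopen_base_prod (T U : topologicalType) :
  clopen_base T -> clopen_base U -> clopen_base (T * U)%type.
Proof.
move=> bT bU [x y] W [[A B] [/= nA nB] ABW].
have [K [clK Kx] KA] := bT _ _ nA; have [L [clL Ly] LB] := bU _ _ nB.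
exists (fst @^-1` K `&` snd @^-1` L).
  split => //; apply: clopenI.
    by apply: preimage_clopen => // z; exact: cvg_fst.
  by apply: preimage_clopen => // z; exact: cvg_snd.
by move=> [u v] [/= /KA Au /LB Bv]; exact: ABW.
Qed.

(** If [f] were nowhere locally constant in [W], decreasing nonempty clopen sets could avoid its
    countably many values one by one; by compactness they share a point, whose value would be
    excluded. *)
Lemma baire_locally_constant (T : topologicalType) (S : Type) (f : T -> S) :
  compact [set: T] -> clopen_base T -> countable (range f) ->
  (forall x : T, closed [set y | f y = f x]) ->
  forall (x : T) (W : set T), nbhs x W ->
  exists2 y, W y & nbhs y [set z | W z /\ f z = f y].
Proof.
move=> cT bT /countable_injP[code codeI] clf x W /bT[K0 [clK0 K0x] K0W].
apply: contrapT => nloc.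
pose good K := [/\ clopen K, K !=set0 & K `<=` K0].
(* [nK] pairs the code to avoid with the current set; [set0] is a default for sets that are not
   [good], so that [choice] applies. *)
have step (nK : nat * set T) : exists K', good nK.2 ->
    [/\ good K', K' `<=` nK.2 & forall z, K' z -> code (f z) <> nK.1].
  case: nK => n K /=; have [gK|] := pselect (good K); last by exists set0.
  have [cK _ KK0] := gK.
  have [[q [Kq qn]]|Kn] :=
    pselect (exists q, K q /\ code (f q) = n); last first.
    by exists K; split => // z Kz zn; apply: Kn; exists z.
  have [r [Kr rq]] : exists r, K r /\ f r <> f q.
    apply: contrapT => Kconst; apply: nloc; exists q; first exact/K0W/KK0.
    have : nbhs q K by apply: open_nbhs_nbhs; split => //; exact: cK.1.
    apply: filterS => z Kz; split; first exact/K0W/KK0.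
    by apply: contrapT => zq; apply: Kconst; exists z.
  have oV : open (K `&` ~` [set y | f y = f q]).
    by apply: openI; [exact: cK.1|exact: closed_openC].
  have [|L [cL Lr] LV] := bT r _ (open_nbhs_nbhs (conj oV _)); first by split.
  exists L => _; split.
  - by split => //; [exists r|move=> z /LV [/KK0]].
  - by move=> z /LV [].
  - move=> z /LV [_ zq] zn; apply: zq; apply: codeI; first 2 last.
    + by rewrite zn.
    + by apply/mem_set; exists z.
    + by apply/mem_set; exists q.
have [g gP] := choice step.
pose K := fix K n := if n is m.+1 then g (m, K m) else K0.
have goodK n : good (K n).
  by elim: n => [|n /(gP (n, K n))[]//]; split => //; exists x.
have decr m n : (m <= n)%N -> K n `<=` K m.
  move=> /subnK <-; elim: (n - m)%N => [//|k IH] z.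
  have [_ sub _] := gP ((k + m)%N, K (k + m)%N) (goodK (k + m)%N).
  by move=> /sub /IH.
have FF : ProperFilter (filter_from [set: nat] K).
  apply: filter_from_proper; last by move=> n _; case: (goodK n).
  apply: filter_fromT_filter => [|m n]; first by exists 0%N.
  by exists (maxn m n) => z Kz; split; apply: decr Kz;
    rewrite ?leq_maxl ?leq_maxr.
have [|y [_ cly]] := cT _ FF; first exact: filterT.
have Ky n : K n y.
  have [[_ clK] _ _] := goodK n.
  by apply: clK => B; apply: (cly (K n) B); exists n.
pose n := code (f y).
have [_ _ /(_ _ (Ky n.+1))] := gP (n, K n) (goodK n).
exact.
Qed.

(** If the range is infinite, the sets whose complement has finite image form a proper filter; it
    has no cluster point, as [f] takes a single value near each point. *)
Lemma locally_constant_finite_range (T : topologicalType) (S : Type)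
    (f : T -> S) :
  compact [set: T] -> (forall x : T, nbhs x [set y | f y = f x]) ->
  finite_set (range f).
Proof.
move=> cT lf; apply: contrapT => inf.
pose F := [set A : set T | finite_set (f @` ~` A)].
have FF : Filter F.
  split.
  - by rewrite /F /= setCT image_set0; exact: finite_set0.
  - move=> P Q FP FQ; rewrite /F /= setCI image_setU.
    by rewrite finite_setU.
  - move=> P Q PQ; apply: sub_finite_set; apply: image_subset.
    exact: subsetC.
have PF : ProperFilter F by split => //; rewrite /F /= setC0.
have [|x [_ clx]] := cT F PF; first exact: filterT.
have [|z [/= zx]] := clx (~` [set y | f y = f x]) _ _ (lf x); last by [].
rewrite /F /= setCK; apply: sub_finite_set (finite_set1 (f x)).
by move=> _ [y /= yx <-].
Qed.

(** * Finitely many values *)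

Lemma size_le_count (T : eqType) (xs s : seq T) (n : nat) :
  {subset s <= xs} -> (forall v, v \in xs -> count_mem v s <= n)%N ->
  (size s <= size xs * n)%N.
Proof.
elim: xs s => [|x xs IH] s sxs cn.
  by case: s sxs {cn} => // y s /(_ y); rewrite inE eqxx => /(_ isT).
rewrite -(count_predC (pred1 x) s) mulSn leq_add ?cn ?mem_head //.
rewrite -size_filter; apply: IH => [y|v vxs].
  by rewrite mem_filter => /andP[/= yx /sxs]; rewrite inE (negPf yx).
rewrite count_filter (leq_trans _ (cn v _)) ?inE ?vxs ?orbT //.
by apply: sub_count => y /= /andP[].
Qed.

Section FinitelyManyValues.
Variable G : groupType.

Let X := [set [~ g ^+ 2, h] | g in [set: G] & h in [set: G]].

Lemma comm_sq_valueJ (v k : G) : X v -> X (v ^ k).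
Proof.
by move=> [g _ [h _ <-]]; exists (g ^ k) => //; exists (h ^ k) => //;
  rewrite conjRg conjXg.
Qed.

Lemma comm_sq_valueV (v : G) : X v -> X v^-1.
Proof.
move=> [g _ [h _ <-]]; exists g^-1 => //; exists (h ^ (g ^+ 2)) => //.
by rewrite /commg /conjg !expg2 !gnorm.
Qed.

Hypothesis finX : finite_set X.

Let over (s : seq G) := forall x, x \in s -> X x.

Lemma value_pigeonhole (f : nat -> G) : (forall i, X (f i)) ->
  exists i d, (0 < d)%N /\ f (i + d)%N = f i.
Proof.
have [xs Xxs] := (finite_seqP _).1 finX => fX.
apply: contrapT => H.
have fI : {in iota 0 (size xs).+1 &, injective f}.
  suff le i j : (i < j)%N -> f i <> f j.
    by move=> i j _ _ E; case: (ltngtP i j) => // /le; rewrite E.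
  by move=> ij E; apply: H; exists i, (j - i)%N;
    rewrite subn_gt0 ij subnKC // ltnW.
have : uniq (map f (iota 0 (size xs).+1)) by rewrite map_inj_in_uniq ?iota_uniq.
move=> /uniq_leq_size fxs; have : {subset map f (iota 0 (size xs).+1) <= xs}.
  by move=> x /mapP[i _ ->]; have := fX i; rewrite Xxs.
by move/fxs; rewrite size_map size_iota ltnn.
Qed.

Lemma power_centralizes_values (v : G) :
  exists2 k, (0 < k)%N & forall x, X x -> commute x (v ^+ k).
Proof.
have [xs Xxs] := (finite_seqP _).1 finX.
suff H s : over s ->
    exists2 k, (0 < k)%N & forall x, x \in s -> commute x (v ^+ k).
  have [|k k0 ck] := H xs; first by move=> x; rewrite Xxs.
  by exists k => // x; rewrite Xxs => /ck.
elim: s => [|x s IH] sX; first by exists 1%N.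
have [|k k0 ck] := IH; first by move=> y ys; apply: sX; rewrite inE ys orbT.
have Xx : X x by apply: sX; rewrite mem_head.
(* Conjugating by powers of [v] keeps [x] in the finite set [X], so two of these conjugates
   coincide. *)
have [i [d [d0 E]]] :=
  value_pigeonhole (f := fun i => x ^ (v ^+ i)) (fun i => comm_sq_valueJ _ Xx).
have cd : commute x (v ^+ d).
  apply/commgP/conjg_fixP; apply: (@conjg_inj _ (v ^+ i)).
  by rewrite -conjgM -expgnDr addnC.
exists (k * d)%N => [|y]; first by rewrite muln_gt0 k0.
rewrite inE => /predU1P[->|/ck ckd].
  by rewrite mulnC expgnA; exact: commuteX.
by rewrite expgnA; exact: commuteX.
Qed.

(** The power [t] of the value is a square commuting with [X], so the powers of [[~ t, h]] are the
    [[~ t ^+ j, h]] and stay in [X]. Two of them coincide, hence some positive power of [t] commutes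
    with [h]. *)
Lemma power_value_commute (g h : G) :
  exists2 n, (0 < n)%N & commute h ([~ g ^+ 2, h] ^+ n).
Proof.
pose v := [~ g ^+ 2, h]; have [k k0 ck] := power_centralizes_values v.
pose t := v ^+ k ^+ 2; pose x := [~ t, h].
have Xx : X x by exists (v ^+ k) => //; exists h.
have ctx : commute t x by apply/commute_sym/commuteX/ck.
have xE j : x ^+ j = [~ t ^+ j, h].
  have th : t ^ h = t * x by rewrite /x commgEl mulVKg.
  by rewrite (commgEl (t ^+ j)) conjXg th (expgMn j ctx) mulKg.
have Xxj j : X (x ^+ j).
  by rewrite xE /t expgnAC; exists (v ^+ k ^+ j) => //; exists h.
have [i [d [d0 E]]] := value_pigeonhole Xxj.
have xd : x ^+ d = 1 by apply: (mulgI (x ^+ i)); rewrite -expgnDr E mulg1.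
exists (k * 2 * d)%N; first by rewrite !muln_gt0 k0 d0.
by rewrite !expgnA -/t; apply/commute_sym/commgP; rewrite -xE xd.
Qed.

Let prodg (s : seq G) := \prod_(x <- s) x.

Lemma power_value_shorten (v : G) : X v -> exists n t,
  [/\ over t, size t = n & prodg t = v ^+ n.+1].
Proof.
move=> [g _ [h _ <-]]; have [n n0 cn] := power_value_commute g h.
pose v' := [~ g ^+ 2, h]; have Xv' : X v' by exists g => //; exists h.
(* The head equals [v' * v' ^ h], so the whole product is [v'] times the conjugate by [h] of
   [v' ^+ n], which [h] fixes. *)
exists n, ([~ g ^+ 2, h * h] :: nseq n.-1 (v' ^ h)); split.
- move=> x; rewrite inE => /predU1P[->|].
    by exists g => //; exists (h * h).
  by rewrite mem_nseq => /andP[_ /eqP ->]; exact: comm_sq_valueJ.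
- by rewrite /= size_nseq prednK.
- rewrite /prodg big_cons big_nseq iter_mulg_1 -/v'.
  have -> : [~ g ^+ 2, h * h] = v' * v' ^ h.
    by rewrite /v' /commg /conjg !gnorm.
  rewrite -mulgA -expgS prednK // -conjXg expgS; congr (_ * _).
  by apply/conjg_fixP/commgP/commute_sym.
Qed.

(** An admissible exponent can be raised by padding with copies of [v], so the finite set [X] has a
    common one. *)
Lemma power_value_shorten_uniform : exists n, forall v, X v -> exists t,
  [/\ over t, size t = n & prodg t = v ^+ n.+1].
Proof.
have [xs Xxs] := (finite_seqP _).1 finX.
suff H s : over s -> exists n, forall v, v \in s -> exists t,
    [/\ over t, size t = n & prodg t = v ^+ n.+1].
  have [|n nP] := H xs; first by move=> x; rewrite Xxs.
  by exists n => v; rewrite Xxs => /nP.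
elim: s => [|x s IH] sX; first by exists 0%N.
have [|m mP] := IH; first by move=> y ys; apply: sX; rewrite inE ys orbT.
have Xx : X x by apply: sX; rewrite mem_head.
have [n nP] := power_value_shorten Xx.
have ext v a b : X v ->
    (exists t, [/\ over t, size t = a & prodg t = v ^+ a.+1]) ->
    exists t, [/\ over t, size t = (b + a)%N & prodg t = v ^+ (b + a).+1].
  move=> Xv [t [tX st pt]]; exists (nseq b v ++ t); split.
  - move=> y; rewrite mem_cat => /orP[|/tX //].
    by rewrite mem_nseq => /andP[_ /eqP ->].
  - by rewrite size_cat size_nseq st.
  - rewrite /prodg big_cat big_nseq iter_mulg_1 /= -/(prodg t) pt.
    by rewrite -expgnDr addnS.
exists (m + n)%N => v; rewrite inE => /predU1P[->|vs]; first exact: ext.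
rewrite addnC; apply: ext; last exact: mP.
by apply: sX; rewrite inE vs orbT.
Qed.

(** Moving copies of [v] to the front conjugates the factors they pass, and conjugates of values are
    values. *)
Lemma prodg_gather (v : G) (m : nat) (s : seq G) :
  over s -> (m <= count_mem v s)%N ->
  exists t, [/\ over t, (size t + m = size s)%N & prodg s = v ^+ m * prodg t].
Proof.
elim: s m => [|x s IH] [|m] sX //=.
- by exists [::]; rewrite mul1g.
- by exists (x :: s); rewrite /= addn0 mul1g.
have sX' : over s by move=> y ys; apply: sX; rewrite inE ys orbT.
have [->|xv] := eqVneq x v => /=.
  rewrite add1n ltnS => /(IH _ sX')[t [tX st pt]].
  exists t; rewrite addnS st; split => //.
  by rewrite /prodg big_cons -/(prodg s) pt expgS mulgA.
move=> /(IH m.+1 sX')[t [tX st pt]]; exists (x ^ (v ^+ m.+1) :: t); split.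
- move=> y; rewrite inE => /predU1P[->|/tX //].
  by apply/comm_sq_valueJ/sX; rewrite mem_head.
- by rewrite /= addSn st.
- rewrite /prodg !big_cons -/(prodg s) -/(prodg t) pt.
  by rewrite mulgA (conjgC x) -mulgA.
Qed.

(** In a list longer than [size xs * n] some value occurs more than [n] times; gathering [n.+1]
    copies and rewriting them as [n] values shortens the list. *)
Lemma prodg_bounded : exists L, forall s, over s ->
  exists t, [/\ over t, (size t <= L)%N & prodg t = prodg s].
Proof.
have [xs Xxs] := (finite_seqP _).1 finX.
have [n nP] := power_value_shorten_uniform.
exists (size xs * n)%N => s; have [k] := ubnP (size s).
elim: k s => // k IH s; rewrite ltnS => sk sX.
have [small|big] := leqP (size s) (size xs * n); first by exists s.
have [v [vX cv]] : exists v, X v /\ (n < count_mem v s)%N.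
  apply: contrapT => H; move: big; rewrite ltnNge => /negP; apply.
  apply: size_le_count => [y /sX|v vxs]; first by rewrite Xxs.
  by rewrite leqNgt; apply/negP => vn; apply: H; exists v; rewrite Xxs.
have [t [tX st ->]] := prodg_gather sX cv.
have [u [uX su <-]] := nP v vX.
have -> : prodg u * prodg t = prodg (u ++ t) by rewrite /prodg big_cat.
apply: IH; first by rewrite size_cat su; rewrite -st addnS addnC in sk.
by move=> y; rewrite mem_cat => /orP[/uX|/tX].
Qed.

Lemma finite_value_products :
  finite_set [set \prod_(x <- s) x | s in [set s | forall x, x \in s -> X x]].
Proof.
have [L LP] := prodg_bounded.
pose F n := [set prodg s | s in [set s | over s /\ (size s <= n)%N]].
suff FF n : finite_set (F n).
  apply: sub_finite_set (FF L) => _ [s sX <-].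
  by have [t [tX st E]] := LP s sX; exists t.
elim: n => [|n IH].
  apply: sub_finite_set (finite_set1 1) => _ [[|x s] [_ ss] <-] //.
  by rewrite /prodg big_nil.
apply: (@sub_finite_set _ _ ([set 1] `|` [set x * y | x in X & y in F n])).
  move=> _ [[|x s] [sX /= ss] <-]; first by left; rewrite /prodg big_nil.
  right; exists x; first by apply: sX; rewrite mem_head.
  exists (prodg s); last by rewrite /prodg big_cons.
  by exists s; split => // y ys; apply: sX; rewrite inE ys orbT.
by rewrite finite_setU; split; [exact: finite_set1|exact: finite_image2].
Qed.

End FinitelyManyValues.

(** * Countably many values *)

Section TopologicalGroup.
Variable G : topologicalGroupType.

Lemma continuous_mulg (T : topologicalType) (f g : T -> G) :
  continuous f -> continuous g -> continuous (fun x => f x * g x).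
Proof.
move=> cf cg x; apply: (@continuous2_cvg _ _ _ _ _ _ f g (fun a b => a * b)).
- exact: (@mulg_continuous G (f x, g x)).
- exact: cf.
- exact: cg.
Qed.

Lemma continuous_invg (T : topologicalType) (f : T -> G) :
  continuous f -> continuous (fun x => (f x)^-1).
Proof.
move=> cf x; apply: (@continuous_comp _ _ _ f (fun y : G => y^-1)).
  exact: cf.
exact: invg_continuous.
Qed.

Lemma continuous_conjg (T : topologicalType) (f g : T -> G) :
  continuous f -> continuous g -> continuous (fun x => f x ^ g x).
Proof.
move=> cf cg; apply: continuous_mulg; first exact: continuous_invg.
exact: continuous_mulg.
Qed.

Lemma continuous_commg (T : topologicalType) (f g : T -> G) :
  continuous f -> continuous g -> continuous (fun x => [~ f x, g x]).
Proof.
move=> cf cg; apply: continuous_mulg; first exact: continuous_invg.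
exact: continuous_conjg.
Qed.

(* Such a set is an open normal subgroup, openness being equivalent to being a
   neighbourhood of 1. *)
Definition normal_nbhs (M : set G) :=
  [/\ nbhs 1 M, forall x y, M x -> M y -> M (x * y),
      forall x, M x -> M x^-1 & forall x g, M x -> M (x ^ g)].

Lemma normal_nbhs1 M : normal_nbhs M -> M 1.
Proof. by case=> /nbhs_singleton. Qed.

Lemma nbhs_mulg_normal (M : set G) (x : G) : normal_nbhs M ->
  nbhs x [set y | M (y / x)].
Proof.
case=> nM _ _ _.
have cx : continuous (fun y : G => y / x).
  by apply: continuous_mulg => y; [exact: cvg_id|exact: cvg_cst].
by apply: cx; rewrite mulgV.
Qed.

Lemma normal_nbhs_base (U : set G) : compact [set: G] -> clopen_base G ->
  nbhs 1 U -> exists2 M, normal_nbhs M & M `<=` U.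
Proof.
move=> cG bG /bG[K [[oK cK] K1] KU].
pose W := [set h | forall k, K k -> K (k * h)].
(* Compactness of [K] gives one neighbourhood of 1 that works for all [k]. *)
have nW : nbhs 1 W.
  have /compact_near_coveringP : compact K by apply: (subclosed_compact cK cG).
  move=> /(_ _ (nbhs 1) (fun h k => K (k * h))); apply => k Kk.
  apply: (@mulg_continuous G (k, 1)).
  by apply: open_nbhs_nbhs; split; rewrite ?mulg1.
(* Compactness of [G] makes this core of [W] a neighbourhood of 1; inverses are imposed because [W]
   is only a submonoid. *)
pose M := [set m | forall g, W (m ^ g) /\ W (m ^ g)^-1].
have nM : nbhs 1 M.
  have /compact_near_coveringP : compact [set: G] := cG.
  move=> /(_ _ (nbhs 1) (fun m g => W (m ^ g) /\ W (m ^ g)^-1)) H.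
  suff {H} : forall g : G, [set: G] g ->
      \forall g' \near g & m \near 1, W (m ^ g') /\ W (m ^ g')^-1.
    by move=> /H; apply: filterS => m Hm g; exact: Hm.
  move=> g _.
  have cc : continuous (fun p : G * G => p.2 ^ p.1).
    by apply: continuous_conjg => p; [exact: cvg_snd|exact: cvg_fst].
  apply: filterI.
    by apply: (cc (g, 1)); rewrite /= conj1g.
  by apply: (continuous_invg cc (x := (g, 1))); rewrite /= conj1g invg1.
exists M; last first.
  move=> m /(_ 1) [+ _]; rewrite conjg1 => /(_ _ K1).
  by rewrite mul1g => /KU.
split=> //.
- move=> x y Mx My g; have [[Wx Wx'] [Wy Wy']] := (Mx g, My g).
  split => k Kk; rewrite conjMg; first by rewrite mulgA; apply/Wy/Wx.
  by rewrite invgM mulgA; apply: Wx'; exact: Wy'.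
- by move=> x Mx g; have [] := Mx g; rewrite conjVg invgK.
- by move=> x h Mx g; rewrite -conjgM.
Qed.

Lemma normal_nbhsI M N :
  normal_nbhs M -> normal_nbhs N -> normal_nbhs (M `&` N).
Proof.
case=> nM MM MV MJ [nN NM NV NJ]; split.
- exact: filterI.
- by move=> x y [Mx Nx] [My Ny]; split; [exact: MM|exact: NM].
- by move=> x [Mx Nx]; split; [exact: MV|exact: NV].
- by move=> x g [Mx Nx]; split; [exact: MJ|exact: NJ].
Qed.

End TopologicalGroup.

(** * Commutator identities and squares in a coset *)

Lemma commute_divP (G : groupType) (a b h : G) :
  [~ a, h] = [~ b, h] <-> commute h (a / b).
Proof.
split=> [|/commute_sym/commgP/eqP E].
  rewrite /commute /commg /conjg => /(congr1 (fun x => a * (x / h)^-1 / b)).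
  by rewrite !gnorm.
have -> : [~ a, h] = [~ a / b, h] ^ b * [~ b, h].
  by rewrite /commg /conjg !gnorm.
by rewrite E conj1g mul1g.
Qed.

Lemma commgMr_commute (G : groupType) (a k h : G) :
  [~ a, k * h] = [~ a, h] <-> commute a k.
Proof.
have -> : [~ a, k * h] = [~ a, h] * [~ a, k] ^ h.
  by rewrite /commg /conjg !gnorm.
split=> [/(canRL (mulKg _))|/commgP/eqP ->]; last by rewrite conj1g mulg1.
by rewrite mulVg => /eqP; rewrite conjg_eq1 => /commgP.
Qed.

(** This is the map [c_g], since [x ^ g^-1] means [g x g^-1]. *)
Definition sq_cocycle (G : groupType) (g x : G) := x * x ^ g^-1.

Lemma sqrg_mul (G : groupType) (g x : G) :
  (x * g) ^+ 2 = sq_cocycle g x * g ^+ 2.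
Proof. by rewrite /sq_cocycle /conjg !expg2 !gnorm. Qed.

Lemma sqrg_mulK (G : groupType) (g x : G) :
  (x * g) ^+ 2 / g ^+ 2 = sq_cocycle g x.
Proof. by rewrite sqrg_mul mulgK. Qed.

Section CountablyManyValues.
Variable G : topologicalGroupType.
Hypothesis compactG : compact [set: G].
Hypothesis hausdorffG : hausdorff_space G.
Hypothesis baseG : clopen_base G.

Let X := [set [~ g ^+ 2, h] | g in [set: G] & h in [set: G]].
Hypothesis countX : countable X.

Lemma nbhs_translate (y : G) (A : set G) :
  nbhs y A -> nbhs 1 [set x | A (x * y)].
Proof.
move=> nA; have c : continuous (fun x : G => x * y).
  by apply: continuous_mulg => z; [exact: cvg_id|exact: cvg_cst].
by apply: c; rewrite mul1g.
Qed.

Lemma countable_locally_constant (T : topologicalType) (f : T -> G) :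
  compact [set: T] -> clopen_base T -> continuous f -> countable (range f) ->
  forall (x : T) (W : set T), nbhs x W ->
  exists2 y, W y & nbhs y [set z | W z /\ f z = f y].
Proof.
move=> cT bT cf ctf; apply: baire_locally_constant => // x.
have : closed [set f x].
  by apply: accessible_closed_set1; exact: hausdorff_accessible.
by move/continuous_closedP: cf; exact.
Qed.

Lemma continuous_sqrg (T : topologicalType) (f : T -> G) :
  continuous f -> continuous (fun x => f x ^+ 2).
Proof. by move=> cf; apply: continuous_mulg. Qed.

Lemma countable_sub_values (T : Type) (f : T -> G) :
  (forall x, X (f x)) -> countable (range f).
Proof.
move=> fX; apply: sub_countable countX; apply: subset_card_le.
by move=> _ [x _ <-].
Qed.

Lemma comm_sq_value (g h : G) : X [~ g ^+ 2, h].
Proof. by exists g => //; exists h. Qed.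

Lemma centralizer_sqr_nbhs (g : G) :
  exists2 M, normal_nbhs M & forall m, M m -> commute (g ^+ 2) m.
Proof.
pose f h := [~ g ^+ 2, h].
have cf : continuous f.
  by apply: continuous_commg => z; [exact: cvg_cst|exact: cvg_id].
have ctf : countable (range f).
  by apply: countable_sub_values => h; exact: comm_sq_value.
have [y _ ny] :=
  countable_locally_constant compactG baseG cf ctf (filterT : nbhs 1 setT).
have [M nM MU] := normal_nbhs_base compactG baseG (nbhs_translate ny).
by exists M => // m /MU[_ /commgMr_commute].
Qed.

(** The point of local constancy cannot be prescribed, but its first coordinate can be kept in the
    coset of [g] modulo [N]; hence the factor [n0]. *)
Lemma sq_cocycle_centralizes_near (g : G) (N : set G) : normal_nbhs N ->
  exists n0, N n0 /\ exists2 M, normal_nbhs M & M `<=` N /\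
    forall n m, M n -> M m -> commute m (sq_cocycle (n0 * g) n).
Proof.
move=> nN; have [N1 _ _ _] := nN; pose f (p : G * G) := [~ p.1 ^+ 2, p.2].
have cf : continuous f.
  by apply: continuous_commg; [apply: continuous_sqrg|] => z;
    [exact: cvg_fst|exact: cvg_snd].
have ctf : countable (range f).
  by apply: countable_sub_values => h; exact: comm_sq_value.
have cGG : compact [set: G * G].
  by rewrite -setXTT; exact: compact_setX.
have nW : nbhs (g, 1 : G) [set p | N (p.1 / g)].
  exists ([set x | N (x / g)], setT).
    by split; [exact: nbhs_mulg_normal|exact: filterT].
  by case=> u v [].
have [[g' h'] /= Ng' [[A B] [/= nA nB] AB]] :=
  countable_locally_constant cGG (clopen_base_prod baseG baseG) cf ctf nW.
have [M nM MU] := normal_nbhs_base compactG baseG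
  (filterI (filterI (nbhs_translate nA) (nbhs_translate nB)) N1).
exists (g' / g); split => //; exists M => //; split=> [m /MU[]//|n m Mn Mm].
rewrite mulgVK.
(* Varying only the first coordinate, with second coordinate [k * h'], gives this; the cases [k = 1]
   and [k = m] together isolate [m]. *)
have key k : M k -> commute (k * h') (sq_cocycle g' n).
  move=> Mk; rewrite -sqrg_mulK; apply/commute_divP.
  have M1 := normal_nbhs1 nM.
  have F j l : M j -> M l -> f (j * g', l * h') = f (g', h').
    move=> /MU[[Aj _] _] /MU[[_ Bl] _].
    by have [_ ] := AB (j * g', l * h') (conj Aj Bl).
  by have := F n k Mn Mk; rewrite -(F 1 k M1 Mk) mul1g.
have kh := key 1 (normal_nbhs1 nM); rewrite mul1g in kh.
have /commute_sym := key m Mm.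
rewrite -{2}[m](mulgK h') => k2.
by apply: commute_sym; apply: commuteM => //; apply/commuteV/commute_sym.
Qed.

(** Some [g] has [sq_cocycle g] mapping [N] into the centralizer of [N]; commutators in [N] are
    products of such values and their inverses. *)
Lemma nilpotent2_nbhs : exists2 N : set G, normal_nbhs N &
  forall x y z : G, N x -> N y -> N z -> commute z [~ x, y].
Proof.
have nT : normal_nbhs [set: G] by split => //; exact: filterT.
have [g [_ [N nN [_ cN]]]] := sq_cocycle_centralizes_near 1 nT.
rewrite mulg1 in cN; exists N => // x y z Nx Ny Nz.
have [_ NM NV _] := nN.
have Nx' := NV _ Nx; have Ny' := NV _ Ny.
(* Modulo the centre of N, conjugation by [g^-1] is inversion, hence inversion
   is an automorphism. *)
have -> : [~ x, y] = sq_cocycle g (x^-1 * y^-1) *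
    (sq_cocycle g y^-1)^-1 * (sq_cocycle g x^-1)^-1.
  have cxy : commute y (sq_cocycle g x^-1) by exact: cN.
  have E a : a ^ g^-1 = a^-1 * sq_cocycle g a.
    by rewrite /sq_cocycle mulKg.
  have -> : sq_cocycle g (x^-1 * y^-1) =
      x^-1 * y^-1 * (x * sq_cocycle g x^-1 * (y * sq_cocycle g y^-1)).
    by rewrite {1}/sq_cocycle conjMg (E x^-1) (E y^-1) !invgK.
  move: (sq_cocycle g x^-1) (sq_cocycle g y^-1) cxy => a b cya.
  rewrite -(mulgA x) (mulgA a) -cya.
  by rewrite /commg /conjg !gnorm.
apply: commuteM; first apply: commuteM.
- by apply: cN => //; exact: NM.
- by apply: commuteV; exact: cN.
- by apply: commuteV; exact: cN.
Qed.

Lemma sq_cocycle_centralizes (g : G) (N : set G) : normal_nbhs N ->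
  (forall x y z : G, N x -> N y -> N z -> commute z [~ x, y]) ->
  exists2 M : set G, normal_nbhs M & M `<=` N /\
    forall n m, M n -> M m -> commute m (sq_cocycle g n).
Proof.
move=> nN N2.
have [n0 [Nn0 [M nM [MN cM]]]] := sq_cocycle_centralizes_near g nN.
exists M => //; split=> // n m Mn Mm.
have [_ _ NV _] := nN; have [_ _ _ MJ] := nM.
(* Passing from [n0 * g] to [g] costs a commutator of two elements of [N], which [N] centralizes. *)
have -> : sq_cocycle g n =
    sq_cocycle (n0 * g) n * [~ n ^ g^-1, n0^-1]^-1.
  rewrite /sq_cocycle invgM conjgM -[(n ^ g^-1) ^ n0^-1](mulVKg (n ^ g^-1)).
  by rewrite -commgEl; move: (n ^ g^-1) [~ _, _] => s t; rewrite mulgA mulgK.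
apply: commuteM; first exact: cM.
by apply/commuteV/N2; [exact/MN/MJ|exact: NV|exact: MN].
Qed.

(* [x, y] is a product of three squares. *)
Lemma comm_comm_value (x y h : G) : exists a b c,
  [/\ X a, X b, X c & [~ x, y, h] = a * b * c].
Proof.
pose b := x / y.
exists ([~ x^-1 ^+ 2, h] ^ (b ^+ 2 * y ^+ 2)), ([~ b ^+ 2, h] ^ (y ^+ 2)),
  [~ y ^+ 2, h].
split; [exact/comm_sq_valueJ/comm_sq_value..|exact: comm_sq_value|].
have -> : [~ x, y] = x^-1 ^+ 2 * b ^+ 2 * y ^+ 2.
  by rewrite /b /commg /conjg !expg2 !gnorm.
move: (x^-1 ^+ 2) (b ^+ 2) (y ^+ 2) => s t u.
by rewrite /commg /conjg !gnorm.
Qed.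

(** Local constancy is used twice: for the squares of [m * g] it makes [h] commute with
    [sq_cocycle g u * e u], and for [[~ e u, h]] it makes [h] commute with [e u]. *)
Lemma sq_cocycle_commute_near (g h : G) : exists2 U : set G, normal_nbhs U &
  forall u, U u -> commute h (sq_cocycle g u).
Proof.
have [N nN N2] := nilpotent2_nbhs.
have [M nM [MN cM]] := sq_cocycle_centralizes g nN N2.
have [M1 MM MV MJ] := nM; have [_ NM NV NJ] := nN.
pose f m := [~ (m * g) ^+ 2, h].
have cid : continuous (fun x : G => x) by move=> z; exact: cvg_id.
have ccst (a : G) : continuous (fun x : G => a) by move=> z; exact: cvg_cst.
have cf : continuous f.
  by apply/continuous_commg/ccst/continuous_sqrg/continuous_mulg.
have ctf : countable (range f).
  by apply: countable_sub_values => m; exact: comm_sq_value.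
have [m0 Mm0 nm0] := countable_locally_constant compactG baseG cf ctf M1.
have [U nU UM] := normal_nbhs_base compactG baseG
  (filterI (nbhs_translate nm0) M1).
(* The failure of [sq_cocycle g] to be a morphism on N. *)
pose e u := [~ m0, u ^ g^-1].
have eN u : M u -> forall z, N z -> commute z (e u).
  by move=> Mu z Nz; apply: N2 => //; [exact: MN|exact/MN/MJ].
have cU u : U u -> commute h (sq_cocycle g u * e u).
  move=> /UM[[_ /commute_divP]] + Mu.
  rewrite !sqrg_mul.
  have -> : sq_cocycle g (u * m0) = sq_cocycle g u * e u * sq_cocycle g m0.
    have := eN u Mu m0 (MN _ Mm0).
    rewrite /sq_cocycle conjMg /e; move: (u ^ g^-1) (m0 ^ g^-1) => s t H.
    rewrite -(mulgA (u * s)) (mulgA _ m0 t) -H.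
    by rewrite /commg /conjg !gnorm.
  by rewrite mulgKA mulgK.
pose f' u := [~ e u, h].
have cf' : continuous f'.
  apply/continuous_commg/ccst/continuous_commg => //.
  exact: continuous_conjg.
have ctf' : countable (range f').
  (* Each [f' u] is a product of three elements of [X]. *)
  have : countable ((fun p => p.1.1 * p.1.2 * p.2) @` (X `*` X `*` X)).
    apply: sub_countable (countableX (countableX countX countX) countX).
    exact: card_image_le.
  apply: sub_countable; apply: subset_card_le => _ [u _ <-].
  have [a [b [c [Xa Xb Xc E]]]] := comm_comm_value m0 (u ^ g^-1) h.
  by exists (a, b, c); rewrite // /f' /e E.
have [U1 _ _ _] := nU.
have [u1 Uu1 nu1] := countable_locally_constant compactG baseG cf' ctf' U1.
have [V nV VU] := normal_nbhs_base compactG baseG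
  (filterI (nbhs_translate nu1) U1).
exists V => // u /VU[[Uuu1 /commute_divP] + Uu].
have Mu1 : M u1 by case: (UM _ Uu1).
have Mu : M u by case: (UM _ Uu).
have Ne : N (e u) by rewrite /e /commg; apply: NM; [apply/NV/MN|apply/NJ/MN].
(* [e] is multiplicative on [M] because its values there commute with [N]. *)
have -> : e (u * u1) / e u1 = e u.
  rewrite /e conjMg.
  have -> : [~ m0, u ^ g^-1 * u1 ^ g^-1] =
      [~ m0, u1 ^ g^-1] * [~ m0, u ^ g^-1] ^ (u1 ^ g^-1).
    by rewrite /commg /conjg !gnorm.
  have /commute_sym/commgP/conjg_fixP -> : commute (u1 ^ g^-1) (e u).
    by apply: eN => //; exact/MN/MJ.
  by rewrite -/(e u1) -(eN u1 Mu1 (e u) Ne) mulgK.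
move=> he; have := cU u Uu.
by move=> /commuteM/(_ (commuteV he)); rewrite mulgK.
Qed.

(** The square of [x] is [sq_cocycle g (x / g) * g ^+ 2]. Near [(g, h)] the element [y / h] commutes
    with both factors and drops out; then the first factor commutes with [h] and drops out. *)
Lemma comm_sq_locally_constant (g h : G) :
  nbhs (g, h) [set p | [~ p.1 ^+ 2, p.2] = [~ g ^+ 2, h]].
Proof.
have [N nN N2] := nilpotent2_nbhs.
have [M nM [MN cM]] := sq_cocycle_centralizes g nN N2.
have [U nU cU] := sq_cocycle_commute_near g h.
have [C nC cC] := centralizer_sqr_nbhs g.
have nMU := normal_nbhsI nM nU; have nMC := normal_nbhsI nM nC.
exists ([set x | (M `&` U) (x / g)], [set y | (M `&` C) (y / h)]).
  by split; exact: nbhs_mulg_normal.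
move=> [x y] [/= [Mx Ux] [My Cy]].
rewrite -(mulgVK g x) -(mulgVK h y) sqrg_mul.
have -> : [~ sq_cocycle g (x / g) * g ^+ 2, y / h * h] =
    [~ sq_cocycle g (x / g) * g ^+ 2, h].
  apply/commgMr_commute/commute_sym/commuteM; first exact: cM.
  exact/commute_sym/cC.
by apply/commute_divP; rewrite mulgK; exact: cU.
Qed.

Lemma finite_comm_sq_values : finite_set X.
Proof.
have cGG : compact [set: G * G] by rewrite -setXTT; exact: compact_setX.
have := @locally_constant_finite_range _ _ (fun p : G * G => [~ p.1 ^+ 2, p.2])
  cGG (fun p => let: (g, h) := p in comm_sq_locally_constant g h).
apply: sub_finite_set => _ [g _ [h _ <-]].
by exists (g, h).
Qed.

End CountablyManyValues.

Theorem theorem1p3 (G : topologicalGroupType) (profG : profinite G)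
    (countG : countable (word_values comm_sq_word G)) :
  finite_set (verbal_subgroup comm_sq_word G).
Proof.
have [cG hG tG] := profG.
have bG := zero_dimensional_clopen_base cG hG
  (totally_disconnected_zero_dimensional cG hG tG).
rewrite /verbal_subgroup; move: countG; rewrite word_values_comm_sq => countG'.
have finX := finite_comm_sq_values cG hG bG countG'.
have finP := finite_value_products finX.
(* The finite set of products of values contains the values and is a closed subgroup, so it contains
   the verbal subgroup. *)
apply: (sub_finite_set _ finP); apply: smallest_sub; last first.
  move=> v Xv; exists [:: v]; rewrite ?big_seq1 // => x.
  by rewrite inE => /eqP ->.
split; last first.
  by have /accessible_finite_set_closed := hausdorff_accessible hG; apply.
split.
  by apply/mem_set; exists [::]; rewrite ?big_nil.
move=> _ _ /set_mem[s sX <-] /set_mem[t tX <-]; apply/mem_set.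
exists (s ++ rev [seq x^-1 | x <- t]).
  move=> x; rewrite mem_cat mem_rev => /orP[/sX //|/mapP[y /tX Xy ->]].
  exact: comm_sq_valueV.
rewrite big_cat /=; congr (_ * _).
elim: t {tX} => [|y t IH]; first by rewrite !big_nil invg1.
by rewrite rev_cons -cats1 big_cat big_seq1 IH big_cons invgM.
Qed.
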